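(* Up to isomorphism there are exactly nine noncommutative unital associative algebras of dimension $4$ over $\mathbb{F}_2$. With basis $1,x,y,z$, where $1$ is the unit, they are: NA: all products of $x,y,z$ zero except $xy=z$; NB: all products of $x,y,z$ zero except $x^2=z$, $xy=z$, $y^2=z$; NC: all products of $x,y,z$ zero except $x^2=x$, $xy=y$; ND: all products of $x,y,z$ zero except $x^2=x$, $yx=y$; NE: all products of $x,y,z$ zero except $x^2=x$, $xy=y$, $xz=z$; NF: all products of $x,y,z$ zero except $x^2=x$, $yx=y$, $xz=z$; NG: all products of $x,y,z$ zero except $x^2=x$, $y^2=y$, $xz=z$; NH: $x^2=x$, $xy=0$, $yx=y$, $y^2=0$, $xz=z$, $zx=0$, $yz=1+x$, $zy=x$, $z^2=0$ (isomorphic to $M_2(\mathbb{F}_2)$); NI: $x^2=0$, $xy=x+z$, $yx=z$, $y^2=1+y$, $xz=zx=0$, $yz=x+z$, $zy=x$, $z^2=0$. The algebras NC and ND are opposite to each other, and each of the other seven is isomorphic to its opposite.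
   Context: The opposite algebra $A^{op}$ of an algebra $A$ is the same vector space with product $a\cdot_{op}b=ba$. *)

(* Defs.v *)
From HB Require Import structures.
From mathcomp Require Import all_boot all_algebra all_field.

Set Implicit Arguments.
Unset Strict Implicit.
Unset Printing Implicit Defensive.

Import GRing.Theory.
Local Open Scope ring_scope.

Definition noncommutative (F : fieldType) (A : falgType F) : Prop :=
  ~ commutative (@GRing.mul A).

Definition alg_iso (F : fieldType) (A B : falgType F) : Prop :=
  exists f : {lrmorphism A -> B}, bijective f.

(* The opposite algebra of A is the converse ring A^c, which carries the      *)
(* same vector space structure as A; the library only provides its ring       *)
(* structure.                                                                 *)
HB.instance Definition _ (F : fieldType) (A : falgType F) :=
  Vector.copy A^c A.

Fact op_scalerAl (F : fieldType) (A : falgType F) (a : F) (u v : A^c) :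
  a *: (u * v) = (a *: u : A^c) * v.
Proof. exact: (scalerAr a (v : A) (u : A)). Qed.

HB.instance Definition _ (F : fieldType) (A : falgType F) :=
  GRing.Lmodule_isLalgebra.Build F A^c (@op_scalerAl F A).

Fact op_scalerAr (F : fieldType) (A : falgType F) (a : F) (u v : A^c) :
  a *: (u * v) = u * (a *: v : A^c).
Proof. exact: (scalerAl a (v : A) (u : A)). Qed.

HB.instance Definition _ (F : fieldType) (A : falgType F) :=
  GRing.Lalgebra_isAlgebra.Build F A^c (@op_scalerAr F A).

Definition op_alg (F : fieldType) (A : falgType F) : falgType F := A^c.

Inductive label := NA | NB | NC | ND | NE | NF | NG | NH | NI.

(* Row a, column b holds the product a * b, rows and columns being listed in  *)
(* the order 1, x, y, z, where e stands for the unit.                         *)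
Definition table (l : label) (V : zmodType) (e x y z : V) : seq (seq V) :=
  match l with
  | NA => [:: [:: e; x;     y; z    ];
              [:: x; 0;     z; 0    ];
              [:: y; 0;     0; 0    ];
              [:: z; 0;     0; 0    ]]
  | NB => [:: [:: e; x;     y; z    ];
              [:: x; z;     z; 0    ];
              [:: y; 0;     z; 0    ];
              [:: z; 0;     0; 0    ]]
  | NC => [:: [:: e; x;     y; z    ];
              [:: x; x;     y; 0    ];
              [:: y; 0;     0; 0    ];
              [:: z; 0;     0; 0    ]]
  | ND => [:: [:: e; x;     y; z    ];
              [:: x; x;     0; 0    ];
              [:: y; y;     0; 0    ];
              [:: z; 0;     0; 0    ]]
  | NE => [:: [:: e; x;     y; z    ];
              [:: x; x;     y; z    ];
              [:: y; 0;     0; 0    ];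
              [:: z; 0;     0; 0    ]]
  | NF => [:: [:: e; x;     y; z    ];
              [:: x; x;     0; z    ];
              [:: y; y;     0; 0    ];
              [:: z; 0;     0; 0    ]]
  | NG => [:: [:: e; x;     y; z    ];
              [:: x; x;     0; z    ];
              [:: y; 0;     y; 0    ];
              [:: z; 0;     0; 0    ]]
  | NH => [:: [:: e; x;     y; z    ];
              [:: x; x;     0; z    ];
              [:: y; y;     0; e + x];
              [:: z; 0;     x; 0    ]]
  | NI => [:: [:: e; x; y;     z    ];
              [:: x; 0; x + z; 0    ];
              [:: y; z; e + y; x + z];
              [:: z; 0; x;     0    ]]
  end.

Definition has_table (l : label) (A : falgType 'F_2) (x y z : A) : Prop :=
  let b := [:: 1; x; y; z] in
  basis_of fullv b /\
  forall i j : 'I_4, b`_i * b`_j = (nth [::] (table l 1 x y z) i)`_j.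

(* The algebra with underlying space F_2^4, whose standard basis vectors      *)
(* 1, x, y, z multiply according to the table of l.                           *)
Definition alg4 (l : label) : Type := 'rV['F_2]_4.

HB.instance Definition _ (l : label) := Vector.on (alg4 l).

Definition bvec (l : label) (i : 'I_4) : alg4 l := delta_mx 0 i.

Definition bmul (l : label) (i j : 'I_4) : alg4 l :=
  (nth [::] (table l (bvec l 0) (bvec l 1) (bvec l 2) (bvec l 3)) i)`_j.

Definition mul4 (l : label) (u v : alg4 l) : alg4 l :=
  \sum_(i < 4) \sum_(j < 4) (u 0 i * v 0 j) *: bmul l i j.

Section Alg4Theory.
Variable l : label.
Implicit Types u v w : alg4 l.

Lemma mul4_linearl v : linear (fun u => mul4 u v).
Proof.
move=> a u u'; rewrite /mul4 scaler_sumr -big_split; apply: eq_bigr => i _ /=.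
rewrite scaler_sumr -big_split; apply: eq_bigr => j _ /=.
by rewrite !mxE mulrDl scalerDl -mulrA scalerA.
Qed.

Lemma mul4_linearr u : linear (@mul4 l u).
Proof.
move=> a v v'; rewrite /mul4 scaler_sumr -big_split; apply: eq_bigr => i _ /=.
rewrite scaler_sumr -big_split; apply: eq_bigr => j _ /=.
by rewrite !mxE mulrDr scalerDl mulrCA scalerA.
Qed.

Lemma mul4Dl v : {morph (fun u => mul4 u v) : u u' / u + u'}.
Proof. by move=> u u'; have:= mul4_linearl v 1 u u'; rewrite !scale1r. Qed.

Lemma mul4Dr u : {morph (@mul4 l u) : v v' / v + v'}.
Proof. by move=> v v'; have:= mul4_linearr u 1 v v'; rewrite !scale1r. Qed.

Lemma mul40l v : mul4 (0 : alg4 l) v = 0.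
Proof. by apply: (addIr (mul4 0 v)); rewrite -mul4Dl !add0r. Qed.

Lemma mul40r u : mul4 u (0 : alg4 l) = 0.
Proof. by apply: (addIr (mul4 u 0)); rewrite -mul4Dr !add0r. Qed.

Lemma mul4Zl a u v : mul4 (a *: u) v = a *: mul4 u v.
Proof. by have:= mul4_linearl v a u 0; rewrite mul40l !addr0. Qed.

Lemma mul4Zr a u v : mul4 u (a *: v) = a *: mul4 u v.
Proof. by have:= mul4_linearr u a v 0; rewrite mul40r !addr0. Qed.

Lemma mul4_bvec i j : mul4 (bvec l i) (bvec l j) = bmul l i j.
Proof.
rewrite /mul4 (bigD1 i) //= (bigD1 j) //= !mxE !eqxx mul1r scale1r.
rewrite big1 => [|k /negPf kj]; last by rewrite !mxE kj andbF mulr0 scale0r.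
rewrite big1 ?addr0 // => k /negPf ki; rewrite big1 // => m _.
by rewrite !mxE ki andbF mul0r scale0r.
Qed.

Lemma alg4_basis u : u = \sum_(i < 4) u 0 i *: bvec l i.
Proof. exact: row_sum_delta. Qed.

Lemma ord4P (P : 'I_4 -> Prop) : P 0 -> P 1 -> P 2 -> P 3 -> forall i, P i.
Proof.
move=> P0 P1 P2 P3 [[|[|[|[|//]]]] lt_i]; [move: P0|move: P1|move: P2|move: P3];
  by congr P; apply: val_inj.
Qed.

Lemma alg4_add2 u : u + u = 0.
Proof. by rewrite -mulr2n -scaler_nat (_ : 2%:R = 0) ?scale0r //; apply: val_inj. Qed.

Lemma bvec_ind (P : alg4 l -> Prop) :
    P 0 -> (forall u v, P u -> P v -> P (u + v)) ->
    (forall a u, P u -> P (a *: u)) -> (forall i, P (bvec l i)) ->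
  forall u, P u.
Proof.
by move=> P0 PD PZ Pb u; rewrite [u]alg4_basis; elim/big_ind: _ => // i _; apply: PZ.
Qed.

End Alg4Theory.

Lemma mul4_bvecA l i j k :
  mul4 (bvec l i) (mul4 (bvec l j) (bvec l k)) =
  mul4 (mul4 (bvec l i) (bvec l j)) (bvec l k).
Proof.
have addKl (u v : alg4 l) : u + (u + v) = v by rewrite addrA alg4_add2 add0r.
have addKr (u v : alg4 l) : u + v + u = v by rewrite addrAC alg4_add2 add0r.
have simpA := (mul4_bvec, mul4Dl, mul4Dr, mul40l, mul40r).
case: l addKl addKr simpA => addKl addKr simpA;
  elim/ord4P: i; elim/ord4P: j; elim/ord4P: k;
  do 3 ?rewrite ?simpA /bmul /= ?(addr0, add0r, addKl, addKr, alg4_add2) //.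
  by rewrite 1?[bvec NI 3 + _]addrC ?addrK ?addKr // -addrA alg4_add2 addr0.
by rewrite addrC.
Qed.

Fact mul4A l : associative (@mul4 l).
Proof.
elim/bvec_ind => [|u u' IHu IHu'|a u IHu|i] v w; rewrite ?mul40l //.
- by rewrite !mul4Dl IHu IHu'.
- by rewrite !mul4Zl IHu.
elim/bvec_ind: v => [|v v' IHv IHv'|a v IHv|j]; rewrite ?(mul40l, mul40r) //.
- by rewrite !(mul4Dl, mul4Dr) IHv IHv'.
- by rewrite !(mul4Zl, mul4Zr) IHv.
elim/bvec_ind: w => [|w w' IHw IHw'|a w IHw|k]; rewrite ?mul40r //.
- by rewrite !mul4Dr IHw IHw'.
- by rewrite !mul4Zr IHw.
exact: mul4_bvecA.
Qed.

Fact mul41l l : left_id (bvec l 0) (@mul4 l).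
Proof.
elim/bvec_ind => [|u v IHu IHv|a u IHu|i]; rewrite ?mul40r //.
- by rewrite mul4Dr IHu IHv.
- by rewrite mul4Zr IHu.
by rewrite mul4_bvec; case: l; elim/ord4P: i.
Qed.

Fact mul41r l : right_id (bvec l 0) (@mul4 l).
Proof.
elim/bvec_ind => [|u v IHu IHv|a u IHu|i]; rewrite ?mul40l //.
- by rewrite mul4Dl IHu IHv.
- by rewrite mul4Zl IHu.
by rewrite mul4_bvec; case: l; elim/ord4P: i.
Qed.

Fact alg4_oner_neq0 l : bvec l 0 != 0.
Proof. by apply/eqP => /rowP/(_ 0) /eqP; rewrite !mxE. Qed.

HB.instance Definition _ (l : label) :=
  GRing.Zmodule_isNzRing.Build (alg4 l) (@mul4A l) (@mul41l l) (@mul41r l)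
    (fun u u' v => mul4Dl v u u') (@mul4Dr l) (alg4_oner_neq0 l).

HB.instance Definition _ (l : label) :=
  GRing.Lmodule_isLalgebra.Build 'F_2 (alg4 l)
    (fun a u v => esym (mul4Zl a u v)).

HB.instance Definition _ (l : label) :=
  GRing.Lalgebra_isAlgebra.Build 'F_2 (alg4 l)
    (fun a u v => esym (mul4Zr a u v)).

HB.instance Definition _ (l : label) :=
  Algebra_isFalgebra.Build 'F_2 (alg4 l).

(* Main.v *)
(** Choose x and y in A with xy <> yx; then 1, x, y are independent. If for some
  such pair xy is not in span(1, x, y), take the basis 1, x, y, xy; associativity
  then leaves few possible tables. Otherwise xy, yx, x^2 and y^2 lie in
  span(1, x, y) for every noncommuting pair; shifting x and y by scalars makes
  xy a scalar, and any z outside span(1, x, y) can be chosen not to commute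
  with x (replace z by z + y), so that span(1, x, z) is a subalgebra too. In
  both cases a pruned search through the structure constants over F_2 finds, in
  every surviving table, a basis with one of the nine tables. The same boolean
  computation shows that none of the nine algebras contains a basis with the
  table of another, and finds the isomorphisms with the opposite algebras. *)

From HB Require Import structures.
Require Import Defs.
From mathcomp Require Import all_boot all_algebra all_field.

Set Implicit Arguments.
Unset Strict Implicit.
Unset Printing Implicit Defensive.

Import GRing.Theory.
Local Open Scope ring_scope.

(** * Coordinates over F_2 *)

(** Booleans add by exclusive or, so this is the space F_2^4 in a form suited to computation. *)
Definition vec : Type := (bool * bool * bool * bool)%type.
HB.instance Definition _ := GRing.Zmodule.on vec.
HB.instance Definition _ := Finite.on vec.

Definition comb (V : zmodType) (b : seq V) (v : vec) : V :=
  b`_0 *+ v.1.1.1 + b`_1 *+ v.1.1.2 + b`_2 *+ v.1.2 + b`_3 *+ v.2.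

Lemma F2_cases (a : 'F_2) : a = 0 \/ a = 1.
Proof. by case: a => [[|[|//]] lt_a]; [left | right]; apply: val_inj. Qed.

Lemma addvv_F2 (V : lmodType 'F_2) (u : V) : u + u = 0.
Proof. by rewrite -mulr2n -scaler_nat (_ : 2%:R = 0) ?scale0r //; apply: val_inj. Qed.

Lemma combD (V : zmodType) (b : seq V) :
  (forall u : V, u + u = 0) -> {morph comb b : u v / u + v}.
Proof.
move=> V2; have mulrbD (x : V) (c d : bool) : x *+ (c + d)%R = x *+ c + x *+ d.
  by case: c; case: d; rewrite ?addr0 ?add0r //= mulr1n V2.
move=> u v; rewrite /comb !mulrbD [RHS]addrACA; congr (_ + _).
by rewrite [RHS]addrACA; congr (_ + _); rewrite addrACA.
Qed.

Lemma comb0 (V : zmodType) (b : seq V) : comb b 0 = 0.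
Proof. by rewrite /comb /= !mulr0n !addr0. Qed.

Definition coef (v : vec) (i : 'I_4) : 'F_2 :=
  (nth false [:: v.1.1.1; v.1.1.2; v.1.2; v.2] i)%:R.

Definition vec_of (k : 'I_4 -> 'F_2) : vec :=
  (k 0 != 0, k 1 != 0, k 2%:R != 0, k 3%:R != 0).

Lemma coefK : cancel coef vec_of.
Proof. by case=> [[[[] []] []] []]. Qed.

Lemma vec_ofK k : coef (vec_of k) =1 k.
Proof.
have kE (a : 'F_2) : (a != 0)%:R = a by case: (F2_cases a) => ->.
by elim/ord4P; rewrite /coef /= kE.
Qed.

Lemma combE (V : lmodType 'F_2) (b : seq V) v : comb b v = \sum_(i < 4) coef v i *: b`_i.
Proof. by rewrite /comb !big_ord_recr big_ord0 /= add0r !scaler_nat. Qed.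

Lemma nth_map0 (U V : zmodType) (f : U -> V) (b : seq U) i :
  f 0 = 0 -> (map f b)`_i = f b`_i.
Proof.
move=> f0; case: (ltnP i (size b)) => [ltib | leib]; first exact: nth_map.
by rewrite !nth_default ?size_map.
Qed.

Lemma comb_map (U V : zmodType) (f : U -> V) (b : seq U) v : size b = 4 ->
  f 0 = 0 -> {morph f : u v / u + v} -> f (comb b v) = comb (map f b) v.
Proof.
case: b => [|b0 [|b1 [|b2 [|b3 [|//]]]]] // _ f0 fD.
by case: v => [[[[] []] []] []]; rewrite /comb /= ?mulr1n ?mulr0n !fD ?f0.
Qed.

(** Bijectivity of the coordinate map is the form of the basis condition that composes with
    isomorphisms and changes of basis. *)
Lemma basis_comb (V : vectType 'F_2) (b : seq V) : size b = 4 ->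
  basis_of fullv b <-> bijective (comb b).
Proof.
move=> sb; have -> : b = in_tuple b by [].
move: (in_tuple b); rewrite sb => {sb}b; split=> [bB | [g gK Kg]].
  have bF := basis_free bB.
  exists (fun v => vec_of (fun i => coord b i v)) => [v | v].
    rewrite -[RHS]coefK combE; congr (_, _, _, _); congr (_ != 0);
      exact: coord_sum_free.
  rewrite combE; under eq_bigr do rewrite vec_ofK.
  exact/esym/(coord_basis bB)/memvf.
rewrite /basis_of; apply/andP; split.
  rewrite eqEsubv subvf; apply/subvP => v _; rewrite -[v]Kg combE.
  by apply: memv_suml => i _; rewrite memvZ // memv_span // mem_nth ?size_tuple.
apply/freeP => k k0 i; rewrite -[k i]vec_ofK -[vec_of k]gK combE.
under [X in g X]eq_bigr do rewrite vec_ofK.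
rewrite k0 -(comb0 b) gK /coef.
by elim/ord4P: i.
Qed.

(** * Isomorphisms and multiplication tables *)

Section Iso.
Variables (F : fieldType).
Implicit Types A B C : falgType F.

Lemma lrmorphism_inv A B (f : {lrmorphism A -> B}) (g : B -> A) :
  cancel f g -> cancel g f -> exists h : {lrmorphism B -> A}, h =1 g.
Proof.
move=> fK Kf; have fI := can_inj fK.
have gL : linear g by move=> a u v; apply: fI; rewrite Kf linearP /= !Kf.
have gM : GRing.monoid_morphism g.
  by split=> [|u v]; apply: fI; rewrite ?rmorph1 ?rmorphM /= !Kf.
pose gl := GRing.isLinear.Build F B A *:%R g gL.
pose gm := GRing.isMonoidMorphism.Build B A g gM.
pose h : {lrmorphism B -> A} := HB.pack g gl gm.
by exists h.
Qed.

Lemma alg_iso_sym A B : alg_iso A B -> alg_iso B A.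
Proof.
case=> f [g fK Kf]; have [h hE] := lrmorphism_inv fK Kf.
by exists h; exists f => u; rewrite hE.
Qed.

Lemma alg_iso_trans A B C : alg_iso A B -> alg_iso B C -> alg_iso A C.
Proof.
case=> f fB [g gB]; pose h : {lrmorphism A -> C} := g \o f.
by exists h; apply: bij_comp.
Qed.
End Iso.

(** Every table entry is zero or a sum of arguments, so additivity of [f] suffices. *)
Lemma table_map (U V : zmodType) (f : U -> V) l (e x y z : U) i j :
  f 0 = 0 -> {morph f : u v / u + v} ->
  (nth [::] (table l (f e) (f x) (f y) (f z)) i)`_j =
  f (nth [::] (table l e x y z) i)`_j.
Proof.
move=> f0 fD.
by case: l; move: i j => [|[|[|[|i]]]] [|[|[|[|j]]]] //=; rewrite ?fD ?f0 ?nth_nil.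
Qed.

Lemma has_table_map l (A B : falgType 'F_2) (f : {lrmorphism A -> B}) x y z :
  bijective f -> has_table l x y z -> has_table l (f x) (f y) (f z).
Proof.
move=> fB [/basis_comb bB bM]; split.
  apply/basis_comb => //; rewrite -(rmorph1 f).
  apply: (eq_bij (bij_comp fB (bB _))) => // v /=.
  by rewrite (comb_map _ _ (raddf0 f) (raddfD f)).
move=> i j; rewrite -(rmorph1 f) (table_map _ _ _ _ _ _ _ (raddf0 f) (raddfD f)) -bM /= rmorphM.
by congr (_ * _); [elim/ord4P: i | elim/ord4P: j].
Qed.

(** The linear extension of the basis assignment is multiplicative, since products of basis vectors
    on both sides are read off the same table. *)
Lemma has_table_iso l (A : falgType 'F_2) (x y z : A) : has_table l x y z ->
  exists2 f : {lrmorphism alg4 l -> A},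
    bijective f & forall i : 'I_4, f (bvec l i) = [:: 1; x; y; z]`_i.
Proof.
set b := [:: 1; x; y; z] => -[bB bM].
pose f (u : alg4 l) : A := \sum_(i < 4) u 0 i *: b`_i.
have fL : linear f.
  move=> a u v; rewrite /f scaler_sumr -big_split; apply: eq_bigr => i _ /=.
  by rewrite !mxE scalerDl scalerA.
have fb i : f (bvec l i) = b`_i.
  rewrite /f (bigD1 i) //= big1 => [|j /negPf ji]; rewrite !mxE ?eqxx ?ji ?scale0r //.
  by rewrite scale1r addr0.
pose fl := GRing.isLinear.Build 'F_2 (alg4 l) A *:%R f fL.
pose g : {linear alg4 l -> A} := HB.pack f fl.
have fZ a u : g (a *: u) = a *: g u by exact: (GRing.scalable_linear fL).
have fM : GRing.monoid_morphism f.
  split=> [|u v]; first exact: fb 0.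
  change (g (mul4 u v) = f u * f v).
  rewrite raddf_sum {2}/f mulr_suml; apply: eq_bigr => i _.
  rewrite raddf_sum /f mulr_sumr; apply: eq_bigr => j _.
  etransitivity; first exact: fZ.
  rewrite -scalerAl -scalerAr scalerA bM; congr (_ *: _).
  rewrite /bmul -(table_map _ _ _ _ _ _ _ (raddf0 g) (raddfD g)) /=.
  by rewrite !fb.
pose fm := GRing.isMonoidMorphism.Build (alg4 l) A f fM.
pose h : {lrmorphism alg4 l -> A} := HB.pack f fl fm.
exists h => //.
exists (fun v => \row_i coord (in_tuple b) i v) => u /=.
  apply/rowP => i; rewrite mxE; exact: (@coord_sum_free _ _ _ (in_tuple b) _ _ (basis_free bB)).
rewrite /f; under eq_bigr do rewrite mxE.
exact/esym/(@coord_basis _ _ _ _ (in_tuple b) _ bB)/memvf.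
Qed.

(** * Computing with partial multiplication tables *)

Section LazyQuantifiers.
Variables (T : Type) (p : T -> bool).

(* Unlike all and has, these stop early under call-by-value. *)
Fixpoint allif (s : seq T) : bool :=
  if s is x :: s' then if p x then allif s' else false else true.

Fixpoint hasif (s : seq T) : bool :=
  if s is x :: s' then if p x then true else hasif s' else false.

End LazyQuantifiers.

Lemma allifE : @allif = @all. Proof. by []. Qed.

Lemma hasifE : @hasif = @has. Proof. by []. Qed.

Definition vec0 : vec := (false, false, false, false).

(* vadd and veq are + and == on vec, without the structure projections that    *)
(* would dominate the computations.                                           *)
Definition vadd (u v : vec) : vec :=
  let: (a, b, c, d) := u in let: (a', b', c', d') := v in
  (a (+) a', b (+) b', c (+) c', d (+) d').

Definition veq (u v : vec) : bool :=
  let: (a, b, c, d) := vadd u v in ~~ [|| a, b, c | d].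

Definition vecs : seq vec :=
  let B := [:: false; true] in
  [seq (p.1, p.2, q.1, q.2) | p <- [seq (a, b) | a <- B, b <- B],
                              q <- [seq (a, b) | a <- B, b <- B]].

Definition unitv (i : nat) : vec :=
  nth vec0 [:: (true, false, false, false); (false, true, false, false);
               (false, false, true, false); (false, false, false, true)] i.

Lemma vaddE u v : vadd u v = u + v.
Proof. by case: u v => [[[? ?] ?] ?] [[[? ?] ?] ?]. Qed.

Lemma veqP u v : reflect (u = v) (veq u v).
Proof.
apply: (iffP idP); case: u v => [[[[] []] []] []] [[[[] []] []] []] //.
Qed.

Lemma mem_vecs v : v \in vecs.
Proof. by case: v => [[[[] []] []] []]. Qed.

Lemma comb_unitv (V : zmodType) (b : seq V) i : (i < 4)%N ->
  comb b (unitv i) = b`_i.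
Proof.
by case: i => [|[|[|[|//]]]] _; rewrite /comb /= ?mulr0n ?mulr1n ?addr0 ?add0r.
Qed.

(* A partial multiplication table: entry (i, j) is the coordinate vector of   *)
(* the product of the i-th and j-th basis vectors, when it is known.          *)
Definition ptable := seq (seq (option vec)).

Definition pentry (T : ptable) (i j : nat) : option vec :=
  nth None (nth [::] T i) j.

Definition oadd (p q : option vec) : option vec :=
  if p is Some u then if q is Some v then Some (vadd u v) else None else None.

Definition ocomb (r : seq (option vec)) (v : vec) : option vec :=
  let sel (b : bool) i := if b then nth None r i else Some vec0 in
  let: (a, b, c, d) := v in
  oadd (sel a 0) (oadd (sel b 1) (oadd (sel c 2) (sel d 3))).

Definition pmul (T : ptable) (u v : vec) : option vec :=
  ocomb [seq ocomb r v | r <- T] u.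

Definition agree (p q : option vec) : bool :=
  if p is Some u then if q is Some v then veq u v else true else true.

(** Triples involving the unit carry no information, and a side that is still unknown counts as
    agreement. *)
Definition assoc_ok (T : ptable) : bool :=
  allif (fun i => allif (fun j => allif (fun k =>
    agree (obind (pmul T ^~ (unitv k)) (pentry T i j))
          (obind (pmul T (unitv i)) (pentry T j k)))
    (iota 1 3)) (iota 1 3)) (iota 1 3).

Definition indep (s : seq vec) : bool :=
  allif (fun v => if veq v vec0 then true
                  else ~~ agree (ocomb (map Some s) v) (Some vec0)) vecs.

Definition entry_ok (T : ptable) (l : label) (s : seq vec) (i j : nat) : bool :=
  let s_ := nth vec0 s in
  if pmul T (s_ i) (s_ j) is Some w then
    veq w (nth vec0 (nth [::] (table l (s_ 0) (s_ 1) (s_ 2) (s_ 3)) i) j)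
  else false.

(* In every table the products of x and z do not involve y, and z * z does    *)
(* not involve x either; hence the order of the tests.                        *)
Definition realizes (T : ptable) (l : label) : bool :=
  let ok s := allif (fun ij => entry_ok T l s ij.1 ij.2) in
  hasif (fun z =>
    if entry_ok T l [:: unitv 0; vec0; vec0; z] 3 3 then
      hasif (fun x =>
        if ok [:: unitv 0; x; vec0; z] [:: (1, 1); (1, 3); (3, 1)]%N then
          hasif (fun y =>
            if ok [:: unitv 0; x; y; z]
                  [:: (1, 2); (2, 1); (2, 2); (2, 3); (3, 2)]%N
            then indep [:: unitv 0; x; y; z] else false) vecs
        else false) vecs
    else false) vecs.

(** The placeholder [vec0] for a vector not yet chosen is harmless: the entries tested at that stage
    do not mention it. The staged search thus amounts to testing all nine products. *)
Lemma realizesP T l :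
  realizes T l <->
  exists x y z, let s := [:: unitv 0; x; y; z] in
    indep s /\ forall i j, (0 < i < 4)%N -> (0 < j < 4)%N -> entry_ok T l s i j.
Proof.
rewrite /realizes hasifE allifE; move: vecs mem_vecs => V memV.
have zE x y z : entry_ok T l [:: unitv 0; vec0; vec0; z] 3 3 =
                entry_ok T l [:: unitv 0; x; y; z] 3 3 by case: l.
have xzE x y z : all (fun ij => entry_ok T l [:: unitv 0; x; vec0; z] ij.1 ij.2)
                     [:: (1, 1); (1, 3); (3, 1)]%N =
                 all (fun ij => entry_ok T l [:: unitv 0; x; y; z] ij.1 ij.2)
                     [:: (1, 1); (1, 3); (3, 1)]%N by clear zE; case: l.
split=> [/hasP[z _] | [x [y [z [ind ok]]]]].
  case: ifP => // okz /hasP[x _]; case: ifP => // okx /hasP[y _].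
  case: ifP => // oky ind; exists x, y, z; split=> //.
  move: okz okx oky; rewrite (zE x y) (xzE _ y) /=.
  move=> ok33 /and4P[ok11 ok13 ok31 _] /and5P[ok12 ok21 ok22 ok23 /andP[ok32 _]].
  by move=> [|[|[|[|i]]]] [|[|[|[|j]]]].
apply/hasP; exists z; rewrite ?memV // (zE x y) ok //.
apply: (introT hasP); exists x; rewrite ?memV // (xzE _ y) /= !ok //=.
by apply/hasP; exists y; rewrite ?memV //= !ok.
Qed.

Lemma ocomb_map_Some (s : seq vec) v : size s = 4 ->
  ocomb (map Some s) v = Some (comb s v).
Proof.
case: s => [|s0 [|s1 [|s2 [|s3 [|//]]]]] // _.
have selE (e : bool) (u : vec) : (if e then Some u else Some vec0) = Some (u *+ e).
  by case: e.
by case: v => [[[a b] c] d]; rewrite /ocomb /= !selE /= !vaddE !addrA.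
Qed.

Lemma addvv_vec (v : vec) : v + v = 0.
Proof. by case: v => [[[[] []] []] []]. Qed.

Lemma indepP (s : seq vec) : size s = 4 -> indep s <-> bijective (comb s).
Proof.
move=> ss; rewrite /indep allifE.
have agreeE v : agree (ocomb (map Some s) v) (Some vec0) = (comb s v == 0).
  by rewrite ocomb_map_Some //=; apply/veqP/eqP.
split=> [/allP ind | /bij_inj sI].
  (* In characteristic 2 the sum [u + v] is also the difference, so a trivial kernel gives
     injectivity; finiteness of [vec] does the rest. *)
  apply: injF_bij => u v euv; move: (ind (u + v) (mem_vecs _)).
  case: veqP => [uv0 _ | _]; last first.
    by rewrite agreeE combD ?euv ?addvv_vec ?eqxx //; exact: addvv_vec.
  by rewrite -[u]addr0 -(addvv_vec v) addrA uv0 add0r.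
apply/allP => v _; case: veqP => // v0; rewrite agreeE.
by apply/eqP => /esym; rewrite -(comb0 s) => /sI /esym.
Qed.

Definition upd (T : ptable) (i j : nat) (v : vec) : ptable :=
  set_nth [::] T i (set_nth None (nth [::] T i) j (Some v)).

Lemma pentry_upd T i j v i' j' :
  pentry (upd T i j v) i' j' =
  if (i' == i) && (j' == j) then Some v else pentry T i' j'.
Proof.
rewrite /pentry /upd nth_set_nth /=; case: eqP => //= ->.
by rewrite nth_set_nth /=.
Qed.

(** * Partial tables of an actual algebra *)

Section Represents.
Variables (A : falgType 'F_2) (b : seq A).
Hypothesis b4 : size b = 4.

Definition represents (T : ptable) : Prop :=
  forall i j v, pentry T i j = Some v -> b`_i * b`_j = comb b v.

Let bD := combD b (@addvv_F2 A).

(** The family [c] is general because [pmul_sound] uses it twice: for the left multiples of the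
    basis by one of its vectors, and for the right multiples by a fixed element. *)
Lemma ocomb_sound (c : seq A) r u w :
  (forall i v, nth None r i = Some v -> c`_i = comb b v) ->
  ocomb r u = Some w -> comb c u = comb b w.
Proof.
move=> rP; case: u => [[[u0 u1] u2] u3].
have selP (e : bool) i v :
    (if e then nth None r i else Some vec0) = Some v -> c`_i *+ e = comb b v.
  by case: e => [/rP // | [<-]]; rewrite comb0.
have oaddP p q v : oadd p q = Some v ->
    exists2 v1, p = Some v1 & exists2 v2, q = Some v2 & v = v1 + v2.
  by case: p q => [v1|] [v2|] //= [<-]; exists v1; last exists v2; rewrite ?vaddE.
case/oaddP=> v0 /selP e0 [_ /oaddP[v1 /selP e1 [_ /oaddP[v2 /selP e2 [v3 /selP e3 ->]] ->]] ->].
by rewrite !bD -e0 -e1 -e2 -e3 /comb /= !addrA.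
Qed.

Lemma pmul_sound T u v w :
  represents T -> pmul T u v = Some w -> comb b u * comb b v = comb b w.
Proof.
move=> TP; rewrite (comb_map _ b4 (mul0r (comb b v)) (fun x y => mulrDl x y _)).
apply: ocomb_sound => i {}w wE; have ltiT : (i < size T)%N.
  by rewrite ltnNge; apply/negP => Ti; rewrite nth_default ?size_map in wE.
rewrite (nth_map [::]) // in wE.
rewrite (nth_map0 (f := *%R^~ (comb b v))) ?mul0r // (comb_map v b4 (mulr0 _) (mulrDr _)).
by apply: (ocomb_sound _ wE) => j v' /TP <-; rewrite nth_map0 ?mulr0.
Qed.

Lemma represents_upd T i j v :
  represents T -> b`_i * b`_j = comb b v -> represents (upd T i j v).
Proof.
move=> TP bv i' j' w; rewrite pentry_upd.
by case: ifP => [/andP[/eqP-> /eqP->] [<-] | _ /TP].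
Qed.

Hypothesis bB : bijective (comb b).

Lemma represents_agree p q :
  (forall u v, p = Some u -> q = Some v -> comb b u = comb b v) -> agree p q.
Proof.
case: p q => [u|] [v|] //= H; apply/veqP/(bij_inj bB); exact: H.
Qed.

Lemma represents_assoc T : represents T -> assoc_ok T.
Proof.
move=> TP; rewrite /assoc_ok allifE.
apply/allP => i; rewrite mem_iota => /andP[_ lti].
apply/allP => j; rewrite mem_iota => /andP[_ ltj].
apply/allP => k; rewrite mem_iota => /andP[_ ltk].
apply: represents_agree => u v.
case Eij: (pentry T i j) => [p|] //= pu; case Ejk: (pentry T j k) => [q|] //= qv.
rewrite -(pmul_sound TP pu) -(pmul_sound TP qv) -(TP _ _ _ Eij) -(TP _ _ _ Ejk).
by rewrite !comb_unitv // mulrA.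
Qed.

End Represents.

Section Realize.
Variables (A : falgType 'F_2) (b : seq A).
Hypotheses (b4 : size b = 4) (b0 : b`_0 = 1) (bB : bijective (comb b)).

Let bD := combD b (@addvv_F2 A).

(** Coordinates of a good basis compose with [comb b] to give a basis of [A]. Products with the unit
    are treated apart, as [realizes] only tests indices 1 to 3. *)
Lemma realizes_sound T l :
  represents b T -> realizes T l -> exists x y z : A, has_table l x y z.
Proof.
move=> TP /realizesP[x [y [z [/indepP-/(_ erefl) sB ok]]]].
have e1 : comb b (unitv 0) = 1 by rewrite comb_unitv.
exists (comb b x), (comb b y), (comb b z).
rewrite /has_table -e1; split.
  apply/basis_comb => //; apply: (eq_bij (bij_comp bB sB)) => v /=.
  by rewrite (comb_map _ _ (comb0 b) bD).
move=> i j; rewrite (table_map _ _ _ _ _ _ _ (comb0 b) bD).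
have [i0 | i0] := posnP i.
  by rewrite i0 e1 mul1r; case: (l); elim/ord4P: j => /=; rewrite ?e1.
have [j0 | j0] := posnP j.
  by rewrite j0 e1 mulr1; case: (l) i i0; elim/ord4P.
move: (ok i j); rewrite i0 j0 !ltn_ord => /(_ isT isT); rewrite /entry_ok.
case E: pmul => [w|] // /veqP <-; rewrite -(pmul_sound b4 TP E).
by congr (_ * _); [elim/ord4P: i {i0 E}| elim/ord4P: j {j0 E}].
Qed.

(** Totality of the table makes a failed test conclusive; this is what separates the nine
    algebras. *)
Lemma realizes_complete T l (x y z : A) :
  represents b T -> (forall u v, pmul T u v) ->
  has_table l x y z -> realizes T l.
Proof.
move=> TP Ttot; have [g _ Kg] := bB.
rewrite /has_table -b0 -(comb_unitv b) // -[x]Kg -[y]Kg -[z]Kg.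
move: {x y z}(g x) (g y) (g z) => x y z [/basis_comb sB sM].
apply/realizesP; exists x, y, z; set s := [:: unitv 0; x; y; z].
split=> [|i j /andP[_ lti] /andP[_ ltj]].
  have sE w : comb (map (comb b) s) w = comb b (comb s w).
    by rewrite (comb_map _ _ (comb0 b) bD).
  apply/indepP=> //; apply: injF_bij => u v euv; apply: (bij_inj (sB _)) => //.
  by rewrite [LHS]sE [RHS]sE euv.
move: (sM (Ordinal lti) (Ordinal ltj)).
rewrite (table_map _ _ _ _ _ _ _ (comb0 b) bD) /entry_ok /=.
have sE k : [:: comb b (unitv 0); comb b x; comb b y; comb b z]`_k = comb b s`_k.
  exact: (nth_map0 s k (comb0 b)).
rewrite !sE.
have := Ttot s`_i s`_j; case E: (pmul T _ _) => [w|] // _.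
rewrite (pmul_sound b4 TP E) => /(bij_inj bB) ->.
by apply/veqP.
Qed.

End Realize.

(** * Pruned search over tables *)

Definition todo_list := seq (nat * nat * (ptable -> seq vec)).

(* Branches on the entries in todo, pruning non-associative tables and those  *)
(* in which x and y commute; the surviving tables must all realize a label.   *)
Fixpoint search (todo : todo_list) (T : ptable) : bool :=
  if (if pentry T 1 2 is Some u then
        if pentry T 2 1 is Some v then veq u v else false else false) then true
  else if ~~ assoc_ok T then true
  else if todo is (i, j, dom) :: todo' then
    allif (fun v => search todo' (upd T i j v)) (dom T)
  else hasif (realizes T) [:: NE; NA; NB; NC; ND; NF; NG; NH; NI].

Section Search.
Variables (A : falgType 'F_2) (b : seq A).
Hypotheses (b4 : size b = 4) (b0 : b`_0 = 1) (bB : bijective (comb b)).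
Hypothesis b12 : b`_1 * b`_2 <> b`_2 * b`_1.

(** A domain may depend on the entries already filled in, hence the quantification over all tables
    that [b] represents. *)
Fixpoint covered (todo : todo_list) : Prop :=
  if todo is (i, j, dom) :: todo' then
    (forall T, represents b T ->
       exists2 v, v \in dom T & b`_i * b`_j = comb b v) /\ covered todo'
  else True.

(** The true products of [b] trace one path down the search tree. No pruning test fires along it, so
    the path ends at a table realizing some label. *)
Lemma search_sound todo T :
  covered todo -> represents b T -> search todo T ->
  exists l (x y z : A), has_table l x y z.
Proof.
have noncomm T' : represents b T' ->
    (if pentry T' 1 2 is Some u then
       if pentry T' 2 1 is Some v then veq u v else false else false) = false.
  move=> TP; case E12: pentry => [u|] //; case E21: pentry => [v|] //.
  by apply/veqP => uv; case: b12; rewrite (TP _ _ _ E12) (TP _ _ _ E21) uv.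
elim: todo T => [|[[i j] dom] todo IH] T cov TP /=;
  rewrite noncomm // (represents_assoc b4 bB TP) /= ?hasifE ?allifE.
  by do 9?[case: ifP => [/(realizes_sound b4 b0 bB TP) ? _ | _]; first by eexists; eassumption].
case: cov => domP cov /allP sT; have [w /sT + ijw] := domP T TP.
exact: IH (represents_upd TP ijw).
Qed.

End Search.

(** * The nine algebras *)

Definition tab (l : label) : ptable :=
  map (map Some) (table l (unitv 0) (unitv 1) (unitv 2) (unitv 3)).

Definition trp (T : ptable) : ptable :=
  [seq [seq pentry T j i | j <- iota 0 4] | i <- iota 0 4].

Lemma has_table_bij l (A : falgType 'F_2) (x y z : A) :
  has_table l x y z -> bijective (comb [:: 1; x; y; z]).
Proof. by case=> /basis_comb bB _; apply: bB. Qed.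

Lemma represents_tab l (A : falgType 'F_2) (x y z : A) :
  has_table l x y z -> represents [:: 1; x; y; z] (tab l).
Proof.
set b := [:: 1; x; y; z] => -[_ bM] i j v Eij.
have [lti ltj] : (i < 4)%N /\ (j < 4)%N.
  by move: Eij; case: (l); move: i j => [|[|[|[|i]]]] [|[|[|[|j]]]] //=;
    rewrite /pentry /= ?nth_nil.
have {Eij} -> : v =
    (nth [::] (table l (unitv 0) (unitv 1) (unitv 2) (unitv 3)) i)`_j.
  apply: Some_inj; rewrite -Eij.
  by case: (l); move: i j lti ltj {Eij} => [|[|[|[|i]]]] [|[|[|[|j]]]].
rewrite -(table_map _ _ _ _ _ _ _ (comb0 b) (combD b (@addvv_F2 A))).
by rewrite !comb_unitv // -(bM (Ordinal lti) (Ordinal ltj)).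
Qed.

Lemma represents_trp (A : falgType 'F_2) (b : seq A) T :
  represents b T -> @represents (op_alg A) b (trp T).
Proof.
move=> TP i j v Eij; apply: (TP j i).
by move: i j Eij => [|[|[|[|i]]]] [|[|[|[|j]]]]; rewrite /pentry /= ?nth_nil.
Qed.

Lemma pmul_tab_total l u v : pmul (tab l) u v.
Proof.
have /allP/(_ u (mem_vecs u))/allP/(_ v (mem_vecs v)) //:
  all (fun u => all (fun v => isSome (pmul (tab l) u v)) vecs) vecs.
by case: l; vm_compute.
Qed.

Lemma has_table_noncommutative l (A : falgType 'F_2) (x y z : A) :
  has_table l x y z -> noncommutative A.
Proof.
move=> lA AC; have TP := represents_tab lA.
have symm i j : obind (fun u => omap (veq u) (pentry (tab l) j i))
                      (pentry (tab l) i j) != Some false.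
  case Eij: pentry => [u|] //=; case Eji: pentry => [v|] //=.
  apply/eqP => -[/veqP]; apply; apply: (bij_inj (has_table_bij lA)).
  by rewrite -(TP _ _ _ Eij) -(TP _ _ _ Eji) AC.
(* In every table but NG, [x] and [y] do not commute; in NG, [x] and [z] do not. *)
by move: (symm 1%N 2) (symm 1%N 3); case: (l).
Qed.

Lemma has_table_bvec l : has_table l (bvec l 1) (bvec l 2) (bvec l 3).
Proof.
have bE i : [:: bvec l 0; bvec l 1; bvec l 2; bvec l 3]`_(i : 'I_4) = bvec l i.
  by elim/ord4P: i.
split=> [|i j]; last first.
  by rewrite !bE; exact: mul4_bvec.
have combE' v : comb [:: bvec l 0; bvec l 1; bvec l 2; bvec l 3] v = \row_i coef v i.
  by rewrite combE [RHS]row_sum_delta; apply: eq_bigr => i _; rewrite bE mxE.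
apply/basis_comb => //; exists (fun u : alg4 l => vec_of (u 0)) => u.
  rewrite combE' -[RHS]coefK /vec_of; congr (_, _, _, _); by rewrite mxE.
by rewrite combE'; apply/rowP => i; rewrite mxE vec_ofK.
Qed.

(** An isomorphism carries the standard basis to a basis of the target with table [l]; computation
    on the total table of [l'] excludes this unless the labels agree. *)
Lemma alg4_iso_inj l l' : alg_iso (alg4 l) (alg4 l') -> l = l'.
Proof.
case=> f /has_table_map/(_ (has_table_bvec l)).
move/(realizes_complete (b := [:: 1; bvec l' 1; bvec l' 2; bvec l' 3])).
move=> /(_ erefl erefl (has_table_bij (has_table_bvec l')) (tab l')
           (represents_tab (has_table_bvec l')) (pmul_tab_total l')).
by case: l f; case: l' => _; vm_compute.
Qed.

Lemma alg4_self_opposite l : l <> NC -> l <> ND ->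
  alg_iso (op_alg (alg4 l)) (alg4 l).
Proof.
move=> lNC lND; have lT := has_table_bvec l.
(* The transposed table is that of the opposite algebra on the same basis. *)
have realT : realizes (trp (tab l)) l by case: l lNC lND lT => // _ _ _; vm_compute.
have [x [y [z /has_table_iso[f fB _]]]] := realizes_sound (A := op_alg (alg4 l))
  (b := [:: 1; bvec l 1; bvec l 2; bvec l 3]) erefl erefl (has_table_bij lT)
  (represents_trp (represents_tab lT)) realT.
by apply: alg_iso_sym; exists f.
Qed.

(** The two tables are transposes, so the standard basis of [alg4 l] has table [l'] in the opposite
    algebra. [has_table_iso] maps out of [alg4 l'], so its inverse is taken. *)
Lemma op_bvec_iso l l' :
  (forall (V : zmodType) (e x y z : V) (i j : 'I_4),
     (nth [::] (table l e x y z) j)`_i = (nth [::] (table l' e x y z) i)`_j) ->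
  exists2 f : {lrmorphism op_alg (alg4 l) -> alg4 l'},
    bijective f & forall i : 'I_4, f (bvec l i) = bvec l' i.
Proof.
move=> ll'; have [bB bM] := has_table_bvec l.
have : @has_table l' (op_alg (alg4 l)) (bvec l 1) (bvec l 2) (bvec l 3).
  by split=> // i j; rewrite -ll' -bM.
case/has_table_iso=> f [g fK Kf] fb; have [h hE] := lrmorphism_inv fK Kf.
exists h => [|i]; first by exists f => u; rewrite hE.
by rewrite hE -[RHS]fK fb; congr g; elim/ord4P: i.
Qed.

(** These are three of the matrix units; in characteristic 2 the fourth is [1 + x]. *)
Lemma has_table_M2 :
  has_table NH (delta_mx 0 0 : 'M['F_2]_2) (delta_mx 1 0) (delta_mx 0 1).
Proof.
split.
  rewrite basisEfree subvf /= dimvf /dim /= andbT.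
  apply/(@freeP _ _ _ [tuple 1; delta_mx 0 0; delta_mx 1 0; delta_mx 0 1]) => k.
  rewrite !big_ord_recl big_ord0 /= => /matrixP k0.
  move: (k0 1 1) (k0 0 0) (k0 1 0) (k0 0 1).
  rewrite !mxE /= !(mulr0, mulr1, addr0, add0r) => e0 + e2 e3; rewrite e0 add0r => e1.
  by elim/ord4P; [rewrite -e0 | rewrite -e1 | rewrite -e2 | rewrite -e3];
    congr k; apply: val_inj.
by apply: ord4P => /=; apply: ord4P => /=; apply/matrixP => -[[|[|//]] ?] [[|[|//]] ?];
  rewrite !mxE ?big_ord_recl ?big_ord0 /= ?mxE; apply: val_inj.
Qed.

(** * Existence of a tabulated basis *)

Definition ptable0 : ptable :=
  [seq [seq if (i == 0)%N then Some (unitv j)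
            else if (j == 0)%N then Some (unitv i) else None
       | j <- iota 0 4] | i <- iota 0 4].

Definition forced (p : ptable -> option vec) (T : ptable) : seq vec :=
  if p T is Some w then [:: w] else vecs.

(* With z = x * y, associativity often determines a * z = (a * x) * y and     *)
(* z * a = x * (y * a).                                                       *)
Definition todo_xy : todo_list :=
  let mulz i := forced (fun T => obind (pmul T ^~ (unitv 2)) (pentry T i 1)) in
  let zmul j := forced (fun T => obind (pmul T (unitv 1)) (pentry T 2 j)) in
  [:: (2, 1, fun=> vecs); (1, 1, fun=> vecs); (1, 3, mulz 1);
      (3, 1, zmul 1); (2, 2, fun=> vecs); (3, 2, zmul 2);
      (2, 3, mulz 2); (3, 3, mulz 3)]%N.

(* noy and noz are the coordinates of span(1, x, z) and span(1, x, y).         *)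
Definition noy : seq vec := [seq v <- vecs | ~~ v.1.2].
Definition noz : seq vec := [seq v <- vecs | ~~ v.2].

(** Here [x * y] is a scalar, and span(1, x, y) and span(1, x, z) are subalgebras. Nothing is known
    about the products of [y] with [z]. *)
Definition todo_noxy : todo_list :=
  [:: (1, 2, fun=> [:: vec0; unitv 0]); (1, 1, fun=> noz);
      (2, 1, fun=> noz); (2, 2, fun=> noz); (1, 3, fun=> noy); (3, 1, fun=> noy);
      (3, 3, fun=> noy); (2, 3, fun=> vecs); (3, 2, fun=> vecs)]%N.

Lemma search_xy : search todo_xy (upd ptable0 1 2 (unitv 3)).
Proof. by vm_compute. Qed.

Lemma search_noxy : search todo_noxy ptable0.
Proof. by vm_compute. Qed.

Lemma represents_ptable0 (A : falgType 'F_2) (b : seq A) :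
  size b = 4 -> b`_0 = 1 -> represents b ptable0.
Proof.
move=> b4 b0 i j v Eij; have [lti ltj] : (i < 4)%N /\ (j < 4)%N.
  by move: i j Eij => [|[|[|[|i]]]] [|[|[|[|j]]]]; rewrite /pentry /= ?nth_nil.
have {Eij} : (i == 0%N) && (unitv j == v) || (j == 0%N) && (unitv i == v).
  by move: i j lti ltj Eij => [|[|[|[|i]]]] [|[|[|[|j]]]] //= _ _ [<-].
case/orP=> /andP[/eqP-> /eqP<-]; rewrite comb_unitv // b0 ?mul1r ?mulr1 //.
Qed.

Section Existence.
Variable A : falgType 'F_2.
Implicit Types x y z : A.

(* The span is listed backwards so that free_cons adds the newest vector. *)
Lemma noncomm_free x y : x * y <> y * x -> free [:: y; x; 1].
Proof.
(* The centralizer of [u] is a subspace containing 1 and [u]; a linear dependence would therefore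
   force [x] and [y] to commute. *)
have cent (u v : A) : v \in <<[:: u; 1%R]>>%VS -> u * v = v * u.
  have /subvP/[apply] : (<<[:: u; 1%R]>> <= 'C[u])%VS.
    apply/span_subvP => w; rewrite mem_seq2.
    by case/orP=> /eqP->; [exact: cent1v_id | exact: cent1v1].
  by move/cent1vP.
move=> xy; rewrite 2!free_cons seq1_free oner_neq0 andbT; apply/andP; split.
  by apply/negP => /cent.
apply/negP => x1; apply: xy; apply/esym/cent.
by rewrite span_cons; apply: subvP x1; rewrite span_seq1 addvSr.
Qed.

Lemma span3P (a c d p : A) : p \in <<[:: a; c; d]>>%VS ->
  exists k0 k1 k2 : bool, p = a *+ k0 + c *+ k1 + d *+ k2.
Proof.
have kE (k : 'F_2) (u : A) : k *: u = u *+ (k != 0).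
  by case: (F2_cases k) => ->; rewrite ?scale0r ?scale1r.
move=> /(@coord_span _ _ _ [tuple a; c; d]) ->.
rewrite !big_ord_recl big_ord0 /= addr0 !kE addrA.
by do 3!eexists.
Qed.

Hypothesis dimA : \dim {: A} = 4.

Lemma free_comb_bij x y z :
  free [:: z; y; x; 1] -> bijective (comb [:: 1; x; y; z]).
Proof.
move=> zF; apply/basis_comb => //; rewrite basisEfree subvf dimA /= andbT.
by rewrite -(perm_free (_ : perm_eq (rev [:: 1; x; y; z]) _)) // perm_rev.
Qed.

Lemma comb_surj (b : seq A) p :
  bijective (comb b) -> exists2 v, v \in vecs & p = comb b v.
Proof. by case=> g _ Kg; exists (g p); rewrite ?mem_vecs ?Kg. Qed.

Lemma table_of_indep_mul x y : x * y <> y * x ->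
  x * y \notin <<[:: y; x; 1%R]>>%VS ->
  exists l (x' y' z' : A), has_table l x' y' z'.
Proof.
move=> xyC xyS; set b := [:: 1; x; y; x * y].
have bB : bijective (comb b).
  by apply: free_comb_bij; rewrite free_cons xyS noncomm_free.
have b12 : b`_1 * b`_2 <> b`_2 * b`_1 by [].
have T0P : represents b (upd ptable0 1 2 (unitv 3)).
  apply: represents_upd; last by rewrite comb_unitv.
  exact: represents_ptable0.
apply: (search_sound (todo := todo_xy) _ _ bB b12 _ T0P search_xy) => //.
have anyP i j T : represents b T -> exists2 v, v \in vecs & b`_i * b`_j = comb b v.
  by move=> _; exact: comb_surj.
have forcedP i j p : (forall T v, represents b T -> p T = Some v -> b`_i * b`_j = comb b v) ->
    forall T, represents b T -> exists2 v, v \in forced p T & b`_i * b`_j = comb b v.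
  move=> pP T TP; rewrite /forced; case E: (p T) => [w|]; last exact: anyP TP.
  by exists w; [rewrite inE | exact: pP E].
have mulzP i T v : represents b T ->
    obind (pmul T ^~ (unitv 2)) (pentry T i 1) = Some v -> b`_i * b`_3 = comb b v.
  move=> TP; case E: pentry => [u|//] uv.
  rewrite -(pmul_sound (erefl : size b = 4) TP (uv : pmul T _ _ = _)).
  by rewrite -(TP _ _ _ E) comb_unitv // -mulrA.
have zmulP j T v : represents b T ->
    obind (pmul T (unitv 1)) (pentry T 2 j) = Some v -> b`_3 * b`_j = comb b v.
  move=> TP; case E: pentry => [u|//] uv.
  rewrite -(pmul_sound (erefl : size b = 4) TP (uv : pmul T _ _ = _)).
  by rewrite -(TP _ _ _ E) comb_unitv // mulrA.
by do !split=> //; do ?[exact: anyP]; apply: forcedP => T v TP;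
  [exact: mulzP | exact: zmulP | exact: zmulP | exact: mulzP | exact: mulzP].
Qed.

Section NoIndepMul.
Hypothesis closedA : forall x y, x * y <> y * x -> x * y \in <<[:: y; x; 1%R]>>%VS.

(** The pairs (y, x), (x, y + x) and (y, x + y) do not commute either. Closure for them gives
    [y * x] and, after subtracting the mixed products, the two squares. *)
Lemma noncomm_closed x y : x * y <> y * x -> let S := <<[:: y; x; 1%R]>>%VS in
  [/\ x * x \in S, x * y \in S, y * x \in S & y * y \in S].
Proof.
move=> xyC S.
have [yS xS oS] : [/\ y \in S, x \in S & 1 \in S].
  by split; apply: memv_span; rewrite !inE eqxx ?orbT.
have subS (u v : A) : u \in S -> v \in S -> (<<[:: v; u; 1%R]>> <= S)%VS.
  by move=> uS vS; apply/span_subvP => w; rewrite !inE => /or3P[] /eqP->.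
have xyS : x * y \in S by exact: closedA.
have yxS : y * x \in S.
  by apply: (subvP (subS y x yS xS)); apply: closedA => /esym.
split=> //.
  have: x * (y + x) \in S.
    apply: (subvP (subS x (y + x) xS _)); rewrite ?rpredD //.
    by apply: closedA; rewrite mulrDr mulrDl => /addIr.
  by rewrite mulrDr rpredDl.
have: y * (x + y) \in S.
  apply: (subvP (subS y (x + y) yS _)); rewrite ?rpredD //.
  by apply: closedA; rewrite mulrDr mulrDl => /addIr/esym.
by rewrite mulrDr rpredDl.
Qed.

(* Shifting x and y by scalars makes x * y a scalar. *)
Lemma noncomm_scalar_mul x y : x * y <> y * x ->
  exists (x' y' : A) (k : bool), x' * y' <> y' * x' /\ x' * y' = 1 *+ k.
Proof.
move=> xyC; have [k0 [k1 [k2 xyE]]] := span3P (closedA xyC).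
(* From xy = k0 y + k1 x + k2 follows (x + k0)(y + k1) = k2 + k0 k1, the linear terms cancelling in
   characteristic 2. *)
exists (x + k0%:R), (y + k1%:R), (k2 (+) (k0 && k1)); split.
  move=> xyC'; apply: xyC; have addK (u : A) (k : bool) : u = u + k%:R - k%:R.
    by rewrite addrK.
  rewrite (addK x k0) (addK y k1); apply: commrB (commr_nat _ _).
  by apply/commr_sym/commrB; [apply/commr_sym | apply: commr_nat].
rewrite mulrDl !mulrDr mulr_natr !mulr_natl xyE [X in X + _]addrAC -[y *+ _ + _ + _]addrA.
rewrite addvv_F2 addr0 addrACA addvv_F2 add0r.
by case: (k0) (k1) (k2) => [] [] []; rewrite //= ?addvv_F2 ?addr0 ?add0r.
Qed.

Lemma table_of_closed x y : x * y <> y * x ->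
  exists l (x' y' z' : A), has_table l x' y' z'.
Proof.
case/noncomm_scalar_mul=> {x}{}y [x [k [xyC xyE]]].
have [z zS xzC] : exists2 z, z \notin <<[:: x; y; 1%R]>>%VS & y * z <> z * y.
  have /subvPn[z _ zS] : ~~ (fullv <= <<[:: x; y; 1%R]>>)%VS.
    apply/negP => /dimvS; rewrite dimA leqNgt => /negP; apply.
    exact: leq_ltn_trans (dim_span _) _.
  (* Until the renaming below, [y] is the first factor and [x] the second. If [z] commutes with [y],
     then [z + x] does not, and it still lies outside the span. *)
  case: (eqVneq (y * z) (z * y)) => [yzC | /eqP ?]; last by exists z.
  exists (z + x); last by rewrite mulrDr mulrDl yzC => /addrI.
  by rewrite rpredDr // memv_span // inE eqxx.
move: y x xyC xyE zS xzC => x y xyC xyE zS xzC; set b := [:: 1; x; y; z].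
have bB : bijective (comb b) by apply: free_comb_bij; rewrite free_cons zS noncomm_free.
have [xxS _ yxS yyS] := noncomm_closed xyC.
have [_ xzS zxS zzS] := noncomm_closed xzC.
have T0P : represents b ptable0 by exact: represents_ptable0.
apply: (search_sound (todo := todo_noxy) _ _ bB xyC _ T0P search_noxy) => //.
have anyP i j T : represents b T -> exists2 v, v \in vecs & b`_i * b`_j = comb b v.
  by move=> _; exact: comb_surj.
have nozP i j T : b`_i * b`_j \in <<[:: y; x; 1%R]>>%VS -> represents b T ->
    exists2 v, v \in noz & b`_i * b`_j = comb b v.
  move=> /span3P[k0 [k1 [k2 ->]]] _; exists (k2, k1, k0, false).
    by rewrite mem_filter mem_vecs.
  by rewrite /comb /= addr0 addrC [_ + x *+ _]addrC addrA.
have noyP i j T : b`_i * b`_j \in <<[:: z; x; 1%R]>>%VS -> represents b T ->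
    exists2 v, v \in noy & b`_i * b`_j = comb b v.
  move=> /span3P[k0 [k1 [k2 ->]]] _; exists (k2, k1, false, k0).
    by rewrite mem_filter mem_vecs.
  by rewrite /comb /= addr0 addrC [_ + x *+ _]addrC addrA.
split=> [T _|].
  by exists (k, false, false, false); [case: (k) | rewrite /comb /= !addr0].
by do !split=> //; move=> T; do [exact: anyP | exact: nozP | exact: noyP].
Qed.
End NoIndepMul.

Lemma noncommutative_has_table : noncommutative A ->
  exists l (x y z : A), has_table l x y z.
Proof.
move=> AnC; have bB : bijective (comb (vbasis {:A})).
  by apply/basis_comb; rewrite ?vbasisP // size_tuple.
have [g _ Kg] := bB; set c := comb _ in Kg.
(* Quantifying over coordinates in the finite type [vec] makes both case distinctions decidable. *)
have [/existsP[u /existsP[v /andP[/eqP uvC uvS]]] | noindep] := boolP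
    [exists u, exists v, (c u * c v != c v * c u) &&
                         (c u * c v \notin <<[:: c v; c u; 1%R]>>%VS)].
  exact: table_of_indep_mul uvC uvS.
have [/existsP[u /existsP[v /eqP uvC]] | comm] := boolP
    [exists u, exists v, c u * c v != c v * c u].
  apply: table_of_closed uvC => x y xyC; apply: contraR noindep => xyS.
  by apply/existsP; exists (g x); apply/existsP; exists (g y); rewrite !Kg xyS andbT; apply/eqP.
case: AnC => x y; apply/eqP; apply: contraR comm => xyC.
by apply/existsP; exists (g x); apply/existsP; exists (g y); rewrite !Kg.
Qed.

End Existence.

(** * The classification and the opposite algebras *)

Theorem mainTheorem9 :
  [/\ (forall l : label,
         [/\ has_table l (bvec l 1) (bvec l 2) (bvec l 3),
             \dim {: alg4 l} = 4%N
           & noncommutative (alg4 l)]),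
      (forall A : falgType 'F_2,
         \dim {: A} = 4%N -> noncommutative A ->
         exists! l : label, alg_iso A (alg4 l)),
      alg_iso (alg4 NH) 'M['F_2]_2,
      (exists2 f : {lrmorphism op_alg (alg4 NC) -> alg4 ND},
         bijective f & forall i : 'I_4, f (bvec NC i) = bvec ND i) /\
      (exists2 g : {lrmorphism op_alg (alg4 ND) -> alg4 NC},
         bijective g & forall i : 'I_4, g (bvec ND i) = bvec NC i)
    & (forall l : label, l <> NC -> l <> ND ->
         alg_iso (op_alg (alg4 l)) (alg4 l))].
Proof.
split=> [l|A dimA AnC|||]; last exact: alg4_self_opposite.
- have lT := has_table_bvec l; split=> //; last exact: has_table_noncommutative lT.
  by case: lT => /(@size_basis _ _ _ _ (in_tuple _)).
- have [l [x [y [z /has_table_iso[f fB _]]]]] := noncommutative_has_table dimA AnC.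
  have Al : alg_iso A (alg4 l) by apply: alg_iso_sym; exists f.
  exists l; split=> // l' Al'.
  exact: alg4_iso_inj (alg_iso_trans (alg_iso_sym Al) Al').
- by have [f fB _] := has_table_iso has_table_M2; exists f.
(* The tables of NC and ND are transposes of each other. *)
- by split; apply: op_bvec_iso => V e x y z; apply: ord4P; apply: ord4P.
Qed.
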